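(* For $n\ge 3$ let $G_n=\overline{C_n}$ be the graph complement of the cycle graph $C_n$, and let $G_2$ be the graph with two vertices and no edges. Let $f_k(G)$ be the number of complete subgraphs $K_{k+1}$ of $G$ for $k\ge 0$, and set $f_{-1}(G)=1$. Then for all $n\ge 4$ and all $k\ge 0$, $$f_k(G_n)=f_k(G_{n-1})+f_{k-1}(G_{n-2}).$$ Moreover, for all $n\ge 2$ the total number of simplices $\sum_{k\ge 0} f_k(G_n)$ equals the hyper Fibonacci number $F_n$, where $F_0=1$, $F_1=0$ and $F_n=F_{n-1}+F_{n-2}+1$ for $n\ge 2$.
   Context: All graphs are finite and simple. The graph complement $\overline{G}$ has the same vertices as $G$, and two distinct vertices are adjacent in $\overline G$ iff they are not adjacent in $G$. Simplices of a graph are the vertex sets of its (nonempty) complete subgraphs; a $k$-simplex has $k+1$ vertices. *)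

(* Defs.v *)
From mathcomp Require Import all_boot all_order all_algebra.

Set Implicit Arguments.
Unset Strict Implicit.
Unset Printing Implicit Defensive.

Record sgraph := SGraph {
  vertex :> finType;
  adj : rel vertex;
  adj_sym : symmetric adj;
  adj_irr : irreflexive adj
}.

Section Complement.
Variable G : sgraph.

Definition compl_adj : rel G := fun x y => (x != y) && ~~ adj x y.

Lemma compl_adj_sym : symmetric compl_adj.
Proof. by move=> x y; rewrite /compl_adj eq_sym adj_sym. Qed.

Lemma compl_adj_irr : irreflexive compl_adj.
Proof. by move=> x; rewrite /compl_adj eqxx. Qed.

Definition compl_graph : sgraph := SGraph compl_adj_sym compl_adj_irr.

End Complement.

Section Cycle.
Variable n : nat.

(* [ordS i] is i + 1 mod n. This is the cycle graph for n >= 3; the conjunct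
   [i != j] only matters at n = 1, where it excludes a loop. *)
Definition cycle_adj : rel 'I_n :=
  fun i j => (i != j) && ((j == ordS i) || (i == ordS j)).

Lemma cycle_adj_sym : symmetric cycle_adj.
Proof. by move=> i j; rewrite /cycle_adj eq_sym orbC. Qed.

Lemma cycle_adj_irr : irreflexive cycle_adj.
Proof. by move=> i; rewrite /cycle_adj eqxx. Qed.

Definition cycle_graph : sgraph := SGraph cycle_adj_sym cycle_adj_irr.

Definition edgeless_adj : rel 'I_n := fun _ _ => false.

Definition edgeless_graph : sgraph :=
  @SGraph 'I_n edgeless_adj (fun _ _ => erefl) (fun _ => erefl).

End Cycle.

(* The values at n = 0 and n = 1 are irrelevant. *)
Definition Gn (n : nat) : sgraph :=
  if n == 2 then edgeless_graph 2 else compl_graph (cycle_graph n).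

(* A complete subgraph of a simple graph is determined by its vertex set. *)
Definition complete (G : sgraph) (S : {set G}) : bool :=
  [forall x in S, forall y in S, (x != y) ==> adj x y].

Definition simplices (G : sgraph) (k : nat) : {set {set G}} :=
  [set S : {set G} | complete S & #|S| == k.+1].

(* The index is an integer so that f_{k-1} makes sense at k = 0;
   [Negz 0] is -1 and [Negz m.+1] is -(m + 2). *)
Definition f (G : sgraph) (k : int) : nat :=
  match k with
  | Posz k => #|simplices G k|
  | Negz 0 => 1
  | Negz _.+1 => 0
  end.

Lemma f_large (G : sgraph) (k : nat) : #|G| <= k -> f G k = 0.
Proof.
move=> le_Gk; apply/eqP; rewrite cards_eq0; apply/eqP/setP=> S.
rewrite !inE; apply/negP=> /andP[_ /eqP cardS].
by have := leq_trans (max_card (mem S)) le_Gk; rewrite cardS ltnn.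
Qed.

(* The sum over all k >= 0: by [f_large] the omitted terms vanish. *)
Definition total_simplices (G : sgraph) : nat := \sum_(k < #|G|) f G (Posz k).

Fixpoint hyper_fib (n : nat) : nat :=
  match n with
  | 0 => 1
  | 1 => 0
  | (m.+1 as m1).+1 => hyper_fib m1 + hyper_fib m + 1
  end.

(* Main.v *)
Require Import Defs.
From mathcomp Require Import all_boot all_order all_algebra.

Set Implicit Arguments.
Unset Strict Implicit.
Unset Printing Implicit Defensive.

(** The simplices of the complement of [C_n], together with the empty set, are
    the independent sets of [C_n], that is, the cyclic binary words of length
    [n] in which no two cyclically consecutive letters are both [true].  Give a
    word with [j] letters [true] the weight ['X^j].  The weighted count of these
    words is then the trace of the [n]-th power of the transfer matrix
    [T = (1 'X; 1 0)] of the golden mean shift.  By Cayley-Hamilton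
    [T^2 = T + 'X], so the weighted counts satisfy
    [I_n = I_(n-1) + 'X * I_(n-2)] ([cyclic_poly_rec]).

    Both claims are read off from this single identity of polynomials.  Since
    [f_k] is the coefficient of ['X^(k+1)], including [f_(-1) = 1] for the empty
    set ([f_pred]), comparing coefficients gives the recurrence for [f_k].
    Evaluating at 1 counts the simplices and the empty set, so this value is one
    more than the total number of simplices ([simplex_poly_at1]).  It satisfies
    the Fibonacci recurrence, and subtracting the 1 from each term turns that
    into the hyper Fibonacci recurrence ([cyclic_poly_at1]).

    The matrix itself does not appear: its powers enter only through their
    entries, which up to the weight of the last letter are sums over words with
    prescribed neighbours at both ends ([walk_poly]), and the identity
    [T^2 = T + 'X] is [walk_polySS]. *)

Import GRing.Theory.
Local Open Scope ring_scope.

(** The f-polynomial of the clique complex: the exponent is the number of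
    vertices, one more than the dimension, so that the empty set contributes
    the constant term 1. *)
Definition simplex_poly (G : sgraph) : {poly nat} :=
  \sum_(S : {set G} | complete S) 'X^#|S|.

Lemma coef_simplex_poly (G : sgraph) (k : nat) :
  (simplex_poly G)`_k = #|[set S : {set G} | complete S & #|S| == k]|.
Proof.
rewrite coef_sum -sum1_card [RHS](eq_bigl (fun S => complete S && (#|S| == k))).
  rewrite big_mkcondr; apply: eq_bigr => S _.
  by rewrite coefXn eq_sym; case: ifP => // ->.
by move=> S; rewrite inE.
Qed.

Lemma f_pred (G : sgraph) (k : nat) : f G (Posz k - 1) = (simplex_poly G)`_k.
Proof.
rewrite coef_simplex_poly; case: k => [|k]; last first.
  by rewrite intS addrAC subrr add0r.
rewrite -[LHS]/1%N -(cards1 (set0 : {set G})); apply: eq_card => S.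
rewrite !inE cards_eq0 andbC; case: eqP => //= ->.
by apply/esym/forall_inP => x; rewrite inE.
Qed.

Lemma f_Posz (G : sgraph) (k : nat) : f G (Posz k) = (simplex_poly G)`_k.+1.
Proof. by rewrite coef_simplex_poly. Qed.

Lemma simplex_poly_at1 (G : sgraph) :
  (simplex_poly G).[1] = (total_simplices G).+1.
Proof.
rewrite (@horner_coef_wide _ #|G|.+1).
  rewrite big_ord_recl -f_pred /= /total_simplices mul1r; congr (_.+1).
  by apply: eq_bigr => k _; rewrite expr1n mulr1 -f_Posz.
apply/leq_sizeP => -[|k] // le_Gk.
by rewrite -f_Posz f_large.
Qed.

Definition compat (a b : bool) : bool := ~~ (a && b).

Lemma cycle_compatE (n : nat) (t : n.-tuple bool) :
  cycle compat t = [forall i, compat (tnth t i) (tnth t (ordS i))].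
Proof.
case: n t => [|n] t; first by rewrite tuple0; apply/esym/forallP => -[].
case/tupleP: t => x p.
apply/(pathP false)/forallP => /= H i.
  have lt_ip : (i < size (rcons p x))%N by rewrite size_rcons size_tuple.
  have := H i lt_ip.
  suff -> : nth false (rcons p x) i = tnth [tuple of x :: p] (ordS i).
    by rewrite !(tnth_nth false) -rcons_cons nth_rcons /= size_tuple ltn_ord.
  rewrite (tnth_nth false) nth_rcons size_tuple /=.
  (* The pair closing the cycle is the case where [i] is the last index. *)
  have := ltn_ord i; rewrite ltnS leq_eqVlt => /predU1P[-> | lt_in].
    by rewrite ltnn eqxx modnn.
  by rewrite lt_in modn_small.
rewrite size_rcons size_tuple => lt_in.
have := H (Ordinal lt_in); rewrite !(tnth_nth false) /=.
rewrite -rcons_cons !nth_rcons /= size_tuple lt_in.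
move: lt_in; rewrite ltnS leq_eqVlt => /predU1P[-> | lt_in].
  by rewrite ltnn eqxx modnn.
by rewrite lt_in modn_small.
Qed.

(** Adjacency in the complement of the cycle fails for distinct vertices only
    between [i] and [ordS i].  The bound on [n] ensures that these two are
    distinct: for [n = 1] the single vertex is its own successor, and the
    singleton would be complete but not compatible with itself. *)
Lemma complete_compl_cycle (n : nat) (S : {set compl_graph (cycle_graph n)}) :
  (1 < n)%N ->
  complete S = [forall i, compat (i \in S) (ordS i \in S)].
Proof.
move=> n_gt1; apply/forall_inP/forallP => [H i | H x xS].
  apply/negP => /andP[iS siS].
  have /forall_inP/(_ _ siS) := H i iS.
  suff neq : i != ordS i.
    by rewrite neq /= /compl_adj /= /cycle_adj neq eqxx.
  apply/eqP => /(congr1 val) /=.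
  have := ltn_ord i; rewrite leq_eqVlt => /predU1P[eq_in | lt_in].
    by rewrite eq_in modnn => i0; move: n_gt1; rewrite -eq_in i0.
  by rewrite modn_small // => /eqP; rewrite ltn_eqF.
apply/forall_inP => y yS; apply/implyP => neq.
rewrite /= /compl_adj neq /= /cycle_adj neq /= negb_or.
apply/andP; split; apply/eqP => E.
  by have := H x; rewrite -E /compat xS yS.
by have := H y; rewrite -E /compat xS yS.
Qed.

(** The separately defined graph [Gn 2] is no exception: [cycle_graph 2] is a
    single edge, whose complement is edgeless. *)
Lemma simplex_poly_Gn (n : nat) :
  simplex_poly (Gn n) = simplex_poly (compl_graph (cycle_graph n)).
Proof.
case: n => [|[|[|n]]] //; apply: eq_bigl => S.
apply: eq_forallb => x; congr (_ ==> _).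
apply: eq_forallb => y; congr (_ ==> _); congr (_ ==> _).
by case: x y => [[|[|x]] hx] [[|[|y]] hy].
Qed.

Definition cyclic_poly (n : nat) : {poly nat} :=
  \sum_(t : n.-tuple bool | cycle compat t) 'X^(count id t).

Lemma simplex_poly_cyclic (n : nat) :
  (1 < n)%N -> simplex_poly (Gn n) = cyclic_poly n.
Proof.
move=> n_gt1; rewrite simplex_poly_Gn.
pose supp (t : n.-tuple bool) : {set 'I_n} := [set i | tnth t i].
have suppK : cancel (fun S : {set 'I_n} => [tuple i \in S | i < n]) supp.
  by move=> S; apply/setP => i; rewrite inE tnth_mktuple.
have suppK' : cancel supp (fun S : {set 'I_n} => [tuple i \in S | i < n]).
  by move=> t; apply: eq_from_tnth => i; rewrite tnth_mktuple inE.
rewrite /simplex_poly /= (reindex supp); last first.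
  by apply: onW_bij; exists (fun S : {set 'I_n} => [tuple i \in S | i < n]).
apply: eq_big => [t | t _].
  rewrite complete_compl_cycle // cycle_compatE.
  by apply: eq_forallb => i; rewrite !inE.
congr 'X^_; rewrite cardE -[in RHS](map_tnth_enum t) count_map.
by rewrite size_filter enumT /=; apply: eq_count => i; rewrite !inE.
Qed.

(** The entry at [a] and [b] of the transfer matrix power [T^(n+1)], without
    the weight of [b]: only the [n] free letters between the two are weighted,
    so that [n = 0] and [b = true] need no division by ['X]. *)
Definition walk_poly (a b : bool) (n : nat) : {poly nat} :=
  \sum_(t : n.-tuple bool | path compat a (rcons t b)) 'X^(count id t).

Lemma sum_tuple_cons (n : nat) (P : pred bitseq) (F : bitseq -> {poly nat}) :
  \sum_(t : n.+1.-tuple bool | P t) F t =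
  \sum_(t : n.-tuple bool | P (false :: t)) F (false :: t) +
  \sum_(t : n.-tuple bool | P (true :: t)) F (true :: t).
Proof.
pose h (u : bool * n.-tuple bool) := [tuple of u.1 :: u.2].
rewrite (reindex h); last first.
  exists (fun t : n.+1.-tuple bool => (thead t, [tuple of behead t])).
    by case=> a t _; congr pair; apply: val_inj.
  by move=> t _; rewrite [RHS]tuple_eta.
rewrite big_mkcond -(pair_bigA _ (fun a (t : n.-tuple bool) =>
  if P (a :: t) then F (a :: t) else 0)) /=.
by rewrite big_bool addrC -!big_mkcond.
Qed.

Lemma walk_poly0 (a b : bool) : walk_poly a b 0 = (compat a b)%:R.
Proof.
rewrite /walk_poly big_mkcond (big_pred1 [tuple]) => [|t] /=.
  by rewrite andbT; case: compat.
by rewrite tuple0; apply/esym/eqP.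
Qed.

Lemma walk_polyS (a b : bool) (n : nat) :
  walk_poly a b n.+1 =
  walk_poly false b n + (if a then 0 else 'X * walk_poly true b n).
Proof.
rewrite /walk_poly
  (sum_tuple_cons _ (fun s => path compat a (rcons s b))
                    (fun s => 'X^(count id s))).
congr (_ + _); first by apply: eq_bigl => t; rewrite /= /compat andbF.
case: a => /=; first by rewrite big_pred0.
by rewrite big_distrr; apply: eq_bigr => t _; rewrite exprS.
Qed.

(** The Cayley-Hamilton identity of the transfer matrix.  A walk
    from [true] must step to [false] first, so it has as many continuations as a
    walk from [false] with one free letter less; substituting this once into the
    first-letter recursion gives the identity for either [a]. *)
Lemma walk_polySS (a b : bool) (n : nat) :
  walk_poly a b n.+2 = walk_poly a b n.+1 + 'X * walk_poly a b n.
Proof.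
rewrite (walk_polyS a b n.+1); case: a; last by rewrite (walk_polyS true) addr0.
by rewrite addr0 !walk_polyS addr0.
Qed.

(** Cutting the cycle at its first letter makes that letter the neighbour of
    both ends of the remaining word: this is the trace. *)
Lemma cyclic_polyS (n : nat) :
  cyclic_poly n.+1 = walk_poly false false n + 'X * walk_poly true true n.
Proof.
rewrite /cyclic_poly
  (sum_tuple_cons _ (cycle compat) (fun s => 'X^(count id s))).
by congr (_ + _); rewrite big_distrr; apply: eq_bigr => t _; rewrite exprS.
Qed.

(** The recursion starts from words of length 1, where [cycle compat] excludes
    the word [true] as adjacent to itself. *)
Lemma cyclic_poly_rec (n : nat) :
  cyclic_poly n.+3 = cyclic_poly n.+2 + 'X * cyclic_poly n.+1.
Proof. by rewrite !cyclic_polyS !walk_polySS !mulrDr addrACA. Qed.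

(** The initial values are 1 and 3: length 1 allows only the word [false], and
    length 2 allows all words but the one with two letters [true]. *)
Lemma cyclic_poly_at1 (n : nat) : (cyclic_poly n.+1).[1] = (hyper_fib n.+1).+1.
Proof.
suff [] : (cyclic_poly n.+1).[1] = (hyper_fib n.+1).+1
  /\ (cyclic_poly n.+2).[1] = (hyper_fib n.+2).+1 by [].
elim: n => [|n [IH1 IH2]].
  by rewrite !cyclic_polyS !walk_polyS !walk_poly0 /compat /= !hornerE.
split=> //; rewrite cyclic_poly_rec hornerD mulrC hornerMX mulr1 IH1 IH2.
by rewrite [hyper_fib n.+3]/= addn1 -addnS -addSn.
Qed.

Local Close Scope ring_scope.

Theorem theorem1 :
  (forall n k : nat, 4 <= n ->
     f (Gn n) (Posz k) =
       f (Gn (n - 1)) (Posz k) + f (Gn (n - 2)) (Posz k - 1)%R)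
  /\
  (forall n : nat, 2 <= n -> total_simplices (Gn n) = hyper_fib n).
Proof.
split=> [[|[|[|[|n]]]] // k _ | [|[|n]] // _].
  rewrite f_pred !f_Posz !subSS !subn0 !simplex_poly_cyclic //.
  by rewrite cyclic_poly_rec coefD mulrC coefMX.
apply: succn_inj.
by rewrite -simplex_poly_at1 simplex_poly_cyclic // cyclic_poly_at1.
Qed.
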